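(* If $E$ is a finite commutative semifield of order $q$, then there is a set of $q+1$ mutually unbiased bases in $\mathbb{C}^q$.
   Context: A finite semifield is a finite set $E$ with operations $+$ and $\circ$ such that $(E,+)$ is an abelian group; $\circ$ has an identity $1\neq 0$; $x\circ y=0$ implies $x=0$ or $y=0$; and $\circ$ is left and right distributive over $+$ (associativity of $\circ$ is not required). It is commutative if $x\circ y=y\circ x$ for all $x,y$. A collection of bases of $\mathbb{C}^q$ is mutually unbiased if each basis is orthonormal and there is a constant $\alpha$ such that $|u^*v|^2=\alpha$ whenever $u$ and $v$ belong to different bases of the collection. *)

(* Defs.v *)
From HB Require Import structures.
From mathcomp Require Import all_boot all_order all_algebra.
From mathcomp Require Import sesquilinear spectral.
From mathcomp Require Import finmap.
From mathcomp Require Import reals.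
From mathcomp Require Import complex.

Set Implicit Arguments.
Unset Strict Implicit.
Unset Printing Implicit Defensive.

Import Order.TTheory GRing.Theory Num.Theory.
Local Open Scope ring_scope.
Local Open Scope sesquilinear_scope.

(* The abelian group (E, +) is the zmodType structure of E; [mul] is the
   (possibly nonassociative) product and [one] its identity. *)
Record is_semifield (E : finZmodType) (mul : E -> E -> E) (one : E) : Prop := {
  semifield_one_neq0 : one != 0;
  semifield_mul1l : left_id one mul;
  semifield_mul1r : right_id one mul;
  semifield_mul_eq0 : forall x y, mul x y = 0 -> x = 0 \/ y = 0;
  semifield_mulDl : left_distributive mul +%R;
  semifield_mulDr : right_distributive mul +%R
}.

Section MutuallyUnbiased.
Variables (C : numClosedFieldType) (n : nat).
Implicit Types (u v : 'cV[C]_n) (B : {fset 'cV[C]_n}).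

Definition cdot u v : C := (u ^t* *m v) 0 0.

Definition orthonormal_basis B : Prop :=
  basis_of {: 'cV[C]_n} B /\ {in B &, forall u v, cdot u v = (u == v)%:R}.

(* A collection of bases is a set of (unordered) bases, so its cardinality
   counts distinct bases. *)
Definition mutually_unbiased (S : {fset {fset 'cV[C]_n}}) : Prop :=
  (forall B, B \in S -> orthonormal_basis B) /\
  exists alpha : C, forall B B', B \in S -> B' \in S -> B != B' ->
    forall u v, u \in B -> v \in B' -> `|cdot u v| ^+ 2 = alpha.

End MutuallyUnbiased.

(* Main.v *)
(* Let l be a nontrivial additive character of E.  For each a, (x, y) |->
   l (a (x y)) is a symmetric bicharacter, because the product is commutative,
   so it has a refinement t_a of modulus 1:
   t_a (x + y) = t_a x * t_a y * l (a (x y)).  The vectors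
   x |-> q^(-1/2) t_a x l (b x), b in E, form an orthonormal basis, and for
   distinct a, a' the inner products are Gauss sums of modulus q^(1/2) divided
   by q; the standard basis is the (q+1)-st one.  Both l and t_a come from
   common eigenvectors of commuting (twisted) translation operators, so that
   odd and even characteristic need not be distinguished. *)
Require Import Defs.
From mathcomp Require Import all_boot all_order all_algebra.
From mathcomp Require Import sesquilinear spectral.
From mathcomp Require Import finmap reals complex.
From mathcomp Require Import ring.

Set Implicit Arguments.
Unset Strict Implicit.
Unset Printing Implicit Defensive.

Import Order.TTheory GRing.Theory Num.Theory.
Local Open Scope ring_scope.

(** * Characters and quadratic refinements as common eigenvectors of translations *)

Section TwistedTranslations.
Local Open Scope sesquilinear_scope.
Variables (C : numClosedFieldType) (E : finZmodType).
Implicit Types (w : E -> E -> C) (x y h k : E).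

(** Translation by [h] permutes [E], hence preserves the positive sum of all [|f x|], yet it
    multiplies this sum by [|f h|]. *)
Lemma norm_eq1_of_normM (f : E -> C) :
    f 0 = 1 -> (forall x y, `|f (x + y)| = `|f x| * `|f y|) ->
  forall h, `|f h| = 1.
Proof.
move=> f0 fD h; pose s := \sum_x `|f x|.
have s_neq0 : s != 0.
  rewrite gt_eqF // /s (bigD1 0) //= f0 normr1 ltr_pwDl // ?ltr01 //.
  by rewrite sumr_ge0.
apply: (mulIf s_neq0); rewrite mul1r {2}/s (reindex_inj (addrI h)) /=.
by rewrite mulr_sumr; apply: eq_bigr => x _; rewrite fD.
Qed.

(** Acts on the right on row vectors, read as functions on [E], by sending [f] to x |-> w x h * f (x
    + h); the eigenvectors used below are row vectors. *)
Definition twisted_shift w h : 'M[C]_#|E| :=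
  \matrix_(i, j) (w (enum_val j) h *+ (enum_val i == enum_val j + h)).

Lemma mulmx_twisted_shift m (u : 'M[C]_(m, #|E|)) w h i j :
  (u *m twisted_shift w h) i j =
  w (enum_val j) h * u i (enum_rank (enum_val j + h)).
Proof.
rewrite mxE (bigD1 (enum_rank (enum_val j + h))) //= mxE enum_rankK eqxx.
rewrite mulr1n mulrC big1 ?addr0 // => k neq_k; rewrite mxE.
case: eqP => [kE|_]; last by rewrite mulr0.
by rewrite -kE enum_valK eqxx in neq_k.
Qed.

Lemma twisted_shift_comm w :
    (forall x h k, w x h * w (x + h) k = w x k * w (x + k) h) ->
  forall h k, comm_mx (twisted_shift w h) (twisted_shift w k).
Proof.
move=> wP h k; apply/matrixP=> i j; rewrite !mulmx_twisted_shift !mxE.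
by rewrite !enum_rankK !mulrnAr wP addrAC.
Qed.

Section QuadraticRefinement.
Variable b : E -> E -> C.
Hypothesis b_norm : forall x y, `|b x y| = 1.
Hypothesis b_sym : forall x y, b x y = b y x.
Hypothesis bDl : forall x y z, b (x + y) z = b x z * b y z.

(* A nonzero common eigenvector of the operators
   f |-> (x |-> b x h ^-1 * f (x + h)), which commute because b is symmetric,
   vanishes nowhere, and is a refinement once scaled to take the value 1 at 0. *)
Lemma quadratic_refinement : exists2 t : E -> C,
  forall x, `|t x| = 1 & forall x y, t (x + y) = t x * t y * b x y.
Proof.
have b_neq0 x y : b x y != 0 by rewrite -normr_eq0 b_norm oner_eq0.
have b0 y : b 0 y = 1.
  by apply: (mulIf (b_neq0 0 y)); rewrite -bDl addr0 mul1r.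
pose w x h := (b x h)^-1.
have wP x h k : w x h * w (x + h) k = w x k * w (x + k) h.
  rewrite /w !bDl !invfM (b_sym k h) !mulrA; congr (_ * _).
  by rewrite mulrC.
have E_gt0 : (0 < #|E|)%N by apply/card_gt0P; exists 0.
have [|v v_neq0 /allP vP] :=
    @common_eigenvector C _ [seq twisted_shift w h | h : E] E_gt0.
  move=> _ _ /imageP[h _ ->] /imageP[k _ ->]; exact: twisted_shift_comm.
pose f x := v 0 (enum_rank x).
have fP h : exists c, forall x, f (x + h) = c * f x * b x h.
  have /vP/sub_rVP[c cP] : twisted_shift w h \in [seq twisted_shift w h | h : E].
    exact: image_f.
  exists c => x.
  move/rowP/(_ (enum_rank x)): cP.
  rewrite mulmx_twisted_shift enum_rankK mxE -/(f _) -/(f _) => <-.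
  by rewrite mulrAC /w mulVf ?mul1r.
(* Translations carry 0 to every point, so [f 0 = 0] would force [v = 0]. *)
have f0_neq0 : f 0 != 0.
  apply: contra_neq v_neq0 => f0; apply/rowP=> j; rewrite mxE.
  have [c cP] := fP (enum_val j); have := cP 0.
  by rewrite add0r f0 mulr0 mul0r /f enum_valK.
pose t x := f x / f 0.
have tD x y : t (x + y) = t x * t y * b x y.
  have [c cP] := fP y; rewrite /t cP.
  (* At 0 the relation reads f y = c * f 0, so the eigenvalue [c] is [t y]. *)
  have := cP 0; rewrite add0r b0 mulr1 => ->.
  by rewrite mulfK // [LHS]mulrAC [f x / _ * c]mulrC mulrA.
exists t => //; apply: norm_eq1_of_normM; first by rewrite /t mulfV.
by move=> x y; rewrite tD !normrM b_norm mulr1.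
Qed.

End QuadraticRefinement.

Local Notation shift := (twisted_shift (fun _ _ => 1)).

(** The adjoint of translation by [h] is translation by [- h], which commutes with it; the matrix is
    therefore normal and the spectral theorem applies. *)
Lemma shift_diagonalizable h : diagonalizable (shift h).
Proof.
have shift_adj : (shift h)^t* = shift (- h).
  apply/matrixP=> i j; rewrite !mxE rmorphMn rmorph1.
  by rewrite -subr_eq eq_sym.
have /orthomx_spectralP shE : shift h \is normalmx.
  by apply/normalmxP; rewrite shift_adj; apply: twisted_shift_comm.
exists (spectralmx (shift h)); first exact: spectral_unit.
apply/(similar_diagLR (spectral_unit _)).
exists (spectral_diag (shift h)).
by rewrite conjVmx ?spectral_unit.
Qed.

(* Translations are simultaneously diagonalizable; as a nonzero translation is
   not the identity, it has an eigenvalue other than 1 on some common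
   eigenvector, and the eigenvalues on that vector form a character. *)
Lemma nontrivial_character (h : E) : h != 0 -> exists2 l : E -> C,
  forall x, `|l x| = 1 & (forall x y, l (x + y) = l x * l y) /\ l h != 1.
Proof.
move=> h_neq0.
have [|P Punit /allP PP] :=
    iffLR (@codiagonalizableP C #|E| [seq shift h | h : E]).
  split=> [_ _ /imageP[x _ ->] /imageP[y _ ->]|_ /imageP[x _ ->]].
    exact: twisted_shift_comm.
  exact: shift_diagonalizable.
have {}PP x : exists D, P *m shift x = diag_mx D *m P.
  have /PP/(similar_diagLR Punit)[D DP] :
    shift x \in [seq shift h | h : E] by rewrite image_f.
  by exists D; rewrite DP conjVmx // !mulmxA mulmxV // mul1mx.
have [D DP] := PP h.
have [i Di] : exists i, D 0 i != 1.
  apply/existsP; apply: contraR h_neq0; rewrite negb_exists => /forallP D1.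
  have DE : diag_mx D = 1%:M.
    rewrite -diag_const_mx; congr diag_mx; apply/rowP => i; rewrite mxE.
    by apply/eqP; have := D1 i; rewrite negbK.
  have /(congr1 (mulmx (invmx P))) := DP.
  rewrite DE mul1mx mulKmx // mulVmx //.
  (* At this entry [shift h] has 1, whereas the identity has 0 unless [h = 0]. *)
  move=> /matrixP/(_ (enum_rank h) (enum_rank 0)); rewrite !mxE !enum_rankK.
  rewrite add0r eqxx (inj_eq enum_rank_inj).
  by case: eqP => // _ /eqP; rewrite oner_eq0.
(* The rows of [P] are common eigenvectors of all translations; on row [i] the eigenvalue of
   [shift h] is [D 0 i], different from 1. *)
pose f x := P i (enum_rank x).
have fP x : exists c, forall y, f (y + x) = c * f y.
  have [D' /matrixP D'P] := PP x; exists (D' 0 i) => y.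
  have := D'P i (enum_rank y); rewrite mulmx_twisted_shift mul1r enum_rankK.
  by rewrite mul_diag_mx mxE.
have fh y : f (y + h) = D 0 i * f y.
  move/matrixP/(_ i (enum_rank y)): DP.
  by rewrite mulmx_twisted_shift mul1r enum_rankK mul_diag_mx mxE.
have f0_neq0 : f 0 != 0.
  apply/eqP=> f0; have : row i P != 0.
    apply: contraTneq Punit => Pi0; rewrite -row_free_unit.
    apply/negP=> /row_freeP[Q /(congr1 (row i))].
    rewrite row_mul Pi0 mul0mx => /rowP/(_ i)/eqP.
    by rewrite !mxE eqxx eq_sym oner_eq0.
  apply/negP; rewrite negbK; apply/eqP/rowP=> j; rewrite !mxE.
  have [c cP] := fP (enum_val j); have := cP 0.
  by rewrite add0r f0 mulr0 /f enum_valK.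
pose l x := f x / f 0.
have lD x y : l (x + y) = l x * l y.
  have [c cP] := fP y; rewrite /l cP.
  have := cP 0; rewrite add0r => ->.
  by rewrite mulfK // [RHS]mulrC mulrA.
exists l; last first.
  by split=> //; rewrite /l -[h]add0r fh mulfK.
apply: norm_eq1_of_normM; first by rewrite /l mulfV.
by move=> x y; rewrite lD !normrM.
Qed.

End TwistedTranslations.

(** * Orthonormal bases and unbiased families as finite sets *)

Section UnbiasedFamilies.
Variables (C : numClosedFieldType) (n : nat).

Lemma cdotE (u v : 'cV[C]_n) : cdot u v = \sum_i (u i 0)^* * v i 0.
Proof. by rewrite /cdot mxE; apply: eq_bigr => i _; rewrite !mxE. Qed.

Lemma cdot_suml (I : finType) (u : 'cV[C]_n) (k : I -> C) (v : I -> 'cV[C]_n) :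
  cdot u (\sum_i k i *: v i) = \sum_i k i * cdot u (v i).
Proof.
rewrite /cdot mulmx_sumr summxE; apply: eq_bigr => i _.
by rewrite -scalemxAr mxE.
Qed.

Lemma card_fset_injective (I : finType) (T : choiceType) (f : I -> T) :
  injective f -> #|` [fset f i | i in I]%fset| = #|I|.
Proof.
by move=> /card_imfset->; rewrite cardE.
Qed.

(** Pairing a linear relation with each vector isolates one coefficient, so the vectors are free,
    and their number is the dimension. *)
Lemma orthonormal_basis_fset (J : finType) (v : J -> 'cV[C]_n) :
    #|J| = n -> (forall j k, cdot (v j) (v k) = (j == k)%:R) ->
  orthonormal_basis [fset v j | j in J]%fset.
Proof.
move=> cardJ v_on; set B := [fset _ | _ in _]%fset.
have v_inj : injective v.
  move=> j k vjk; apply/eqP; have := v_on j k; rewrite vjk v_on eqxx.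
  by case: eqP => // _ /eqP; rewrite oner_eq0.
have B_on : {in B &, forall u v, cdot u v = (u == v)%:R}.
  move=> _ _ /imfsetP[j _ ->] /imfsetP[k _ ->].
  by rewrite v_on (inj_eq v_inj).
have sizeB : size B = n by rewrite card_fset_injective.
split=> //; rewrite basisEfree subvf dimvf dim_matrix mulr1 sizeB leqnn.
rewrite !andbT; apply/(@freeP _ _ _ (in_tuple B)) => k sum0 i.
have := cdot_suml (B`_i) k (fun i => (in_tuple B)`_i); rewrite sum0.
rewrite {1}/cdot mulmx0 mxE (bigD1 i) //= B_on ?mem_nth // eqxx mulr1 big1.
  by rewrite addr0.
move=> j ji; rewrite B_on ?mem_nth // nth_uniq ?fset_uniq //.
by rewrite val_eqE eq_sym (negbTE ji) mulr0.
Qed.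

(** The conditions on [alpha] make distinct indices give distinct sets: a basis equal to another
    would have inner products 0 or 1 with it. This yields the cardinality of [S]. *)
Lemma mutually_unbiased_family (I J : finType) (v : I -> J -> 'cV[C]_n) alpha :
    #|J| = n -> (0 < n)%N -> alpha != 0 -> alpha != 1 ->
    (forall i j k, cdot (v i j) (v i k) = (j == k)%:R) ->
    (forall i i', i != i' ->
      forall j k, `|cdot (v i j) (v i' k)| ^+ 2 = alpha) ->
  exists S : {fset {fset 'cV[C]_n}}, #|` S| = #|I| /\ mutually_unbiased S.
Proof.
move=> cardJ n_gt0 alpha0 alpha1 v_on v_mu.
pose B i := [fset v i j | j in J]%fset.
have /card_gt0P[j0 _] : (0 < #|J|)%N by rewrite cardJ.
have B_inj : injective B.
  move=> i i' Bii'; apply/eqP/negPn/negP=> /v_mu mu.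
  have /imfsetP[k _ vk] : v i j0 \in B i' by rewrite -Bii' in_imfset.
  have := mu j0 j0; rewrite vk v_on.
  case: (k == j0); rewrite ?normr1 ?expr1n ?normr0 ?expr0n /= => /eqP.
    by rewrite eq_sym (negbTE alpha1).
  by rewrite eq_sym (negbTE alpha0).
exists [fset B i | i in I]%fset; split; first exact: card_fset_injective.
split=> [_ /imfsetP[i _ ->]|]; first exact: orthonormal_basis_fset.
exists alpha => _ _ /imfsetP[i _ ->] /imfsetP[i' _ ->] neqB.
move=> _ _ /imfsetP[j _ ->] /imfsetP[k _ ->]; apply: v_mu.
by apply: contra_neq neqB => ->.
Qed.

End UnbiasedFamilies.

(** * Character sums and the bases attached to a commutative semifield *)

Section SemifieldBases.
Variables (C : numClosedFieldType) (E : finZmodType).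
Variables (mul : E -> E -> E) (one : E).
Hypothesis semifieldE : is_semifield mul one.
Hypothesis mulC : commutative mul.

Local Notation "x ∘ y" := (mul x y) (at level 40, left associativity).

Let mulDl := semifield_mulDl semifieldE.
Let mulDr := semifield_mulDr semifieldE.

Lemma semifield_mul0x x : 0 ∘ x = 0.
Proof. by apply: (addIr (0 ∘ x)); rewrite -mulDl !add0r. Qed.

Lemma semifield_mulx0 x : x ∘ 0 = 0.
Proof. by rewrite mulC semifield_mul0x. Qed.

Lemma semifield_mulBl x y z : (x - y) ∘ z = x ∘ z - y ∘ z.
Proof. by apply: (addIr (y ∘ z)); rewrite -mulDl !subrK. Qed.

Lemma semifield_mulBr x y z : x ∘ (y - z) = x ∘ y - x ∘ z.
Proof. by apply: (addIr (x ∘ z)); rewrite -mulDr !subrK. Qed.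

Lemma semifield_mulI x : x != 0 -> injective (mul x).
Proof.
move=> x_neq0 y z /eqP; rewrite -subr_eq0 -semifield_mulBr => /eqP.
case/(semifield_mul_eq0 semifieldE) => /eqP; first by rewrite (negbTE x_neq0).
by rewrite subr_eq0 => /eqP.
Qed.

Variable l : E -> C.
Hypothesis l_norm : forall x, `|l x| = 1.
Hypothesis lD : forall x y, l (x + y) = l x * l y.
Hypothesis l_neq1 : exists x, l x != 1.

Lemma character0 : l 0 = 1.
Proof.
have l_neq0 : l 0 != 0 by rewrite -normr_eq0 l_norm oner_eq0.
by apply: (mulIf l_neq0); rewrite -lD addr0 mul1r.
Qed.

Lemma characterB x y : l (x - y) = l x * (l y)^*.
Proof.
have ly : l y * (l y)^* = 1 by rewrite -normCK l_norm expr1n.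
by rewrite -[in RHS](subrK y x) [in RHS]lD -mulrA ly mulr1.
Qed.

(** An injective [f] permutes [E], and translation by some [h] with [l h != 1] multiplies the full
    sum of [l] by [l h]. *)
Lemma sum_character (f : E -> E) : injective f -> \sum_x l (f x) = 0.
Proof.
move=> f_inj; have [h lh] := l_neq1.
have <- : \sum_x l x = \sum_x l (f x) by exact: reindex_inj.
apply/eqP; have : (1 - l h) * \sum_x l x == 0.
  rewrite mulrBl mul1r subr_eq0 mulr_sumr {1}(reindex_inj (addrI h)) /=.
  by apply/eqP/eq_bigr => x _; rewrite lD.
by rewrite mulf_eq0 subr_eq0 eq_sym (negbTE lh).
Qed.

(* Substituting x + h for x in |sum g|^2 leaves, for each h, a character sum
   that vanishes unless h = 0. *)
Lemma gauss_sum (a : E) (g : E -> C) : a != 0 -> (forall x, `|g x| = 1) ->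
    (forall x h, g (x + h) = g x * g h * l (a ∘ (x ∘ h))) ->
  `|\sum_x g x| ^+ 2 = #|E|%:R.
Proof.
move=> a_neq0 g_norm gD.
have gK x : g x * (g x)^* = 1 by rewrite -normCK g_norm expr1n.
rewrite normCK rmorph_sum mulr_sumr.
have gE x : (\sum_y g y) * (g x)^* = \sum_h g h * l (a ∘ (x ∘ h)).
  rewrite mulr_suml (reindex_inj (addrI x)); apply: eq_bigr => h _.
  rewrite gD -mulrA [l _ * _]mulrC mulrA [g x * _]mulrC.
  by rewrite -(mulrA (g h)) gK mulr1.
under eq_bigr do rewrite gE.
rewrite exchange_big (bigD1 0) //= [X in _ + X]big1 ?addr0 => [|h h_neq0].
  have g0 : g 0 = 1.
    have g0_neq0 : g 0 != 0 by rewrite -normr_eq0 g_norm oner_eq0.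
    apply: (mulIf g0_neq0); have := gD 0 0.
    by rewrite addr0 !semifield_mulx0 character0 mulr1 mul1r => <-.
  rewrite g0 (eq_bigr (fun=> 1)) ?sumr_const // => x _.
  by rewrite !semifield_mulx0 character0 mulr1.
(* For nonzero [a] and [h] this map is injective, since there are no zero divisors. *)
rewrite -mulr_sumr (sum_character (f := fun x => a ∘ (x ∘ h))) ?mulr0 //.
move=> x y /(semifield_mulI a_neq0); rewrite mulC [y ∘ h]mulC.
exact: semifield_mulI.
Qed.

Lemma semifield_refinement (a : E) : exists2 t : E -> C,
  forall x, `|t x| = 1 &
  forall x y, t (x + y) = t x * t y * l (a ∘ (x ∘ y)).
Proof.
apply: quadratic_refinement => [//|x y|x y z]; first by rewrite [x ∘ y]mulC.
by rewrite mulDl mulDr lD.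
Qed.

(** [None] indexes the standard basis and [Some a] the basis built from [t a], so that [option E]
    counts q + 1 bases. *)
Definition semifield_vector (t : E -> E -> C) (i : option E) (b : E) :
    'cV[C]_#|E| :=
  \col_j let x := enum_val j in
    if i is Some a then (sqrtC #|E|%:R)^-1 * (t a x * l (b ∘ x))
    else (x == b)%:R.

Lemma semifield_card_gt1 : (1 < #|E|)%N.
Proof.
apply/card_gt1P; exists 0, one; split=> //.
by rewrite eq_sym (semifield_one_neq0 semifieldE).
Qed.

Lemma semifield_mutually_unbiased :
  exists S : {fset {fset 'cV[C]_#|E|}},
    #|` S| = #|E|.+1 /\ mutually_unbiased S.
Proof.
have [t t_norm tD] := fin_all_exists2 semifield_refinement.
set q := #|E|; set v := semifield_vector t.
have q_gt1 : (1 < q)%N := semifield_card_gt1.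
have q_neq0 : q%:R != 0 :> C by rewrite pnatr_eq0 -lt0n ltnW.
have s_sqr : (sqrtC q%:R)^-1 ^+ 2 = q%:R^-1 :> C by rewrite exprVn sqrtCK.
have s_ge0 : 0 <= (sqrtC q%:R)^-1 :> C by rewrite invr_ge0 sqrtC_ge0 ler0n.
have v_some a a' b b' : cdot (v (Some a) b) (v (Some a') b') =
    q%:R^-1 * \sum_x (t a x)^* * t a' x * l ((b' - b) ∘ x).
  rewrite cdotE mulr_sumr (reindex _ (onW_bij _ (enum_val_bij E))) /=.
  apply: eq_bigr => j _; rewrite !mxE.
  rewrite semifield_mulBl characterB !rmorphM /= (CrealP (ger0_real s_ge0)).
  by rewrite -s_sqr; ring.
have v_none i b b' :
    cdot (v None b) (v i b') = v i b' (enum_rank b) 0.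
  rewrite cdotE (bigD1 (enum_rank b)) //= [v None b _ _]mxE /= enum_rankK eqxx.
  rewrite rmorph1 mul1r big1 ?addr0 // => j jb; rewrite [v None b _ _]mxE /=.
  case: eqP => [jE|_]; last by rewrite rmorph0 mul0r.
  by rewrite -jE enum_valK eqxx in jb.
have v_none_some a b b' : `|cdot (v None b) (v (Some a) b')| ^+ 2 = q%:R^-1.
  by rewrite v_none mxE /= !normrM t_norm l_norm !mulr1 ger0_norm.
rewrite -card_option; apply: (@mutually_unbiased_family _ _ _ E v q%:R^-1).
- by [].
- exact: ltnW.
- by rewrite invr_eq0.
(* Here q > 1 matters, which holds because [one] differs from 0. *)
- by rewrite invr_eq1 pnatr_eq1 gtn_eqF.
- case=> [a|] b b'; last by rewrite v_none mxE /= enum_rankK.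
  rewrite v_some (eq_bigr (fun x => l ((b' - b) ∘ x))) => [|x _]; last first.
    by rewrite [_^* * _]mulrC -normCK t_norm expr1n mul1r.
  have [->|neq_b] := eqVneq b b'.
    rewrite subrr (eq_bigr (fun=> 1)) ?sumr_const ?mulVf // => x _.
    by rewrite semifield_mul0x character0.
  rewrite sum_character ?mulr0 //; apply: semifield_mulI.
  by rewrite subr_eq0 eq_sym.
- case=> [a|] [a'|] // neq_i b b'; last first.
    (* Conjugation swaps the arguments of [cdot] and reduces this case to [v_none_some]. *)
    rewrite -norm_conjC (_ : _^* = cdot (v None b') (v (Some a) b)) //.
    rewrite !cdotE rmorph_sum; apply: eq_bigr => j _.
    by rewrite rmorphM /= conjCK mulrC.
  (* The summand refines the bicharacter of [a' - a], so the squared modulus is q^-2 * q. *)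
  rewrite v_some normrM exprMn (gauss_sum (a := a' - a)); first last.
  - move=> x h; rewrite !tD mulDr lD (semifield_mulBl a') characterB !rmorphM /=.
    ring.
  - by move=> x; rewrite !normrM norm_conjC !t_norm l_norm !mulr1.
  - by rewrite subr_eq0; apply: contra_neq neq_i => ->.
  by rewrite ger0_norm ?invr_ge0 // expr2 -mulrA mulVf ?mulr1.
Qed.

End SemifieldBases.

Local Open Scope fset_scope.

Theorem corollary5p1p3 (R : realType) (E : finZmodType)
    (mul : E -> E -> E) (one : E) (q : nat)
    (semifieldE : is_semifield mul one) (mulC : commutative mul)
    (cardE : #|E| = q) :
  exists S : {fset {fset 'cV[R[i]]_q}},
    #|` S| = q.+1 /\ mutually_unbiased S.
Proof.
(* The nonzero element at which the character must be nontrivial is taken to be [one]. *)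
have [l l_norm [lD l_one]] :=
  nontrivial_character R[i] (semifield_one_neq0 semifieldE).
rewrite -cardE; apply: (semifield_mutually_unbiased semifieldE mulC l_norm lD).
by exists one.
Qed.
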